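(* For every integer $\lambda$ set $b(\lambda)=\frac{5\lambda^2-3\lambda}{2}$, and for every integer $n\ge 0$ define the polynomial \[ Q(n)=\sum_{-\left\lfloor \frac{n-1}{5}\right\rfloor\le\lambda\le\left\lfloor\frac{n+2}{5}\right\rfloor}(-1)^\lambda x^{b(\lambda)}\genfrac{[}{]}{0pt}{}{n}{\left\lfloor\frac{n-1+5\lambda}{2}\right\rfloor}, \] where $\lambda$ ranges over integers. Then $Q(0)=0$, $Q(1)=1$, and for all integers $n\ge 2$, \[ Q(n)=Q(n-1)+x^{n-1}Q(n-2). \]
   Context: Here $x$ is an indeterminate. For integers $n,k$, the Gaussian binomial coefficient is \[ \genfrac{[}{]}{0pt}{}{n}{k}=\frac{(x^n-1)(x^{n-1}-1)\cdots(x^{n-k+1}-1)}{(x-1)(x^2-1)\cdots(x^k-1)} \] when $n,k,n-k\ge 0$ (a polynomial in $x$ with integer coefficients, equal to $1$ when $k=0$), and $\genfrac{[}{]}{0pt}{}{n}{k}=0$ if any of $n,k,n-k$ is negative. An empty sum is $0$. The limits of summation simply indicate the non-vanishing terms; equivalently $\lambda$ may range over all integers. *)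

(* Defs.v *)
From mathcomp Require Import all_boot all_order all_algebra.
From mathcomp Require Import ring zify.

Set Implicit Arguments.
Unset Strict Implicit.
Unset Printing Implicit Defensive.

Import Order.TTheory GRing.Theory Num.Theory.
Local Open Scope ring_scope.

(* The integers l with a <= l <= b, in increasing order; empty if b < a. *)
Definition zrange (a b : int) : seq int :=
  [seq a + i%:Z | i <- iota 0 `|Num.max 0 (b - a + 1)|].

Lemma mem_zrange a b l : (l \in zrange a b) = (a <= l <= b).
Proof.
apply/mapP/idP => [[i]|/andP[al lb]].
  by rewrite mem_iota => hi ->; lia.
by exists `|l - a|%N; [rewrite mem_iota; lia | lia].
Qed.

Lemma zrange_uniq a b : uniq (zrange a b).
Proof. by rewrite map_inj_uniq ?iota_uniq // => i j; lia. Qed.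

Definition gauss_num (n k : nat) : {poly int} :=
  \prod_(i < k) ('X^(n - i) - 1).

Definition gauss_den (k : nat) : {poly int} :=
  \prod_(i < k) ('X^(i.+1) - 1).

(* The polynomial division is exact: see gauss_binomK. *)
Definition gauss_binom (n k : int) : {poly int} :=
  if [&& 0 <= n, 0 <= k & 0 <= n - k]
  then gauss_num `|n| `|k| %/ gauss_den `|k| else 0.

Lemma gauss_den_monic k : gauss_den k \is monic.
Proof.
by apply: monic_prod => i _; rewrite -[1]/(1%:P); apply: monicXnsubC.
Qed.

Lemma gauss_num_dvd n k : exists c, gauss_num n k = c * gauss_den k.
Proof.
elim: n k => [|n IHn] [|k].
- by exists 1; rewrite /gauss_num /gauss_den !big_ord0 mulr1.
- by exists 0; rewrite /gauss_num big_ord_recl subn0 expr0 subrr !mul0r.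
- by exists 1; rewrite /gauss_num /gauss_den !big_ord0 mulr1.
have numSS : gauss_num n.+1 k.+1 = ('X^(n.+1) - 1) * gauss_num n k.
  by rewrite /gauss_num big_ord_recl.
have numS : gauss_num n k.+1 = gauss_num n k * ('X^(n - k) - 1).
  by rewrite /gauss_num big_ord_recr.
have denS : gauss_den k.+1 = gauss_den k * ('X^(k.+1) - 1).
  by rewrite /gauss_den big_ord_recr.
have [c1 e1] := IHn k; have [c2 e2] := IHn k.+1.
have [lekn|ltnk] := leqP k n.
  exists (c1 + 'X^(k.+1) * c2); rewrite mulrDl -mulrA -e2 denS mulrA -e1.
  rewrite numSS numS; have -> : n.+1 = (k.+1 + (n - k))%N by lia.
  by rewrite exprD; set g := gauss_num n k; ring.
exists 0; rewrite mul0r numSS.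
by rewrite [gauss_num n k](bigD1 (Ordinal ltnk)) //= subnn expr0 subrr mul0r mulr0.
Qed.

Lemma gauss_binomK (n k : nat) : (k <= n)%N ->
  gauss_binom n k * gauss_den k = gauss_num n k.
Proof.
move=> lekn; have [c e] := gauss_num_dvd n k.
rewrite /gauss_binom ifT; last by lia.
rewrite !absz_nat e Pdiv.IdomainMonic.mulpK //.
exact: gauss_den_monic.
Qed.

(* The numerator is even and nonnegative for every integer l, so neither the
   integer division nor the absolute value in Q below alters the exponent. *)
Definition b (l : int) : int := ((5 * l ^+ 2 - 3 * l) %/ 2)%Z.

(* Division by a positive integer in int is the floor of the quotient. *)
Definition Q (n : nat) : {poly int} :=
  \sum_(l <- zrange (- ((n%:Z - 1) %/ 5)%Z) ((n%:Z + 2) %/ 5)%Z)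
    (-1) ^ l * 'X^(`|b l|%N) * gauss_binom n%:Z ((n%:Z - 1 + 5 * l) %/ 2)%Z.

(* Main.v *)
Require Import Defs.
From mathcomp Require Import all_boot all_order all_algebra.
From mathcomp Require Import ring zify.
Import Order.TTheory GRing.Theory Num.Theory.
Local Open Scope ring_scope.

(** The recurrence holds because, summand by summand, its defect telescopes.

    Fix the row [m] and compare the summands of [Q m.+2], [Q m.+1] and
    ['X^(m.+1) * Q m] with the same index [l].  Their lower entries are [k],
    [k - 1], [k - 1] when [m + 1 + 5 l = 2 k], and [k], [k], [k - 1] when
    [m + 5 l = 2 k].  In either case the two q-Pascal rules, applied one after
    the other, cancel everything but a single binomial of row [m], with lower
    entry [k] in the first case and [k - 2] in the second
    ([gauss_defect_low], [gauss_defect_high]).  Since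
    [(m + 5 l) / 2 - 2 = (m + 1 + 5 (l - 1)) / 2], the survivor at [l] in the
    second case has the lower entry of the survivor at [l - 1] in the first; the
    quadratic exponent [b] is such that the powers of ['X] agree as well, and
    the signs are opposite.  So the defect at [l] is
    [remainder m l - remainder m (l - 1)] ([term_defect]).

    Gaussian binomials vanish outside their range, hence the three sums may be
    taken over one long interval ([Q_wide]); there the defect telescopes to two
    boundary remainders, both of them zero. *)

(** * Sums over integer intervals *)

Lemma sum_zrange_wide (V : nmodType) (F : int -> V) (a c a' c' : int) :
  a' <= a -> c <= c' -> (forall l, ~~ (a <= l <= c) -> F l = 0) ->
  \sum_(l <- zrange a c) F l = \sum_(l <- zrange a' c') F l.
Proof.
move=> aa cc F0; rewrite [RHS](bigID (fun l => a <= l <= c)) /=.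
rewrite [X in _ + X]big1 ?addr0; last by move=> l; apply: F0.
rewrite -[RHS]big_filter; apply: perm_big; apply: uniq_perm.
- exact: zrange_uniq.
- by rewrite filter_uniq // zrange_uniq.
by move=> l; rewrite mem_filter !mem_zrange; lia.
Qed.

Lemma telescope_zrange (V : zmodType) (F : int -> V) (a c : int) :
  a <= c + 1 ->
  \sum_(l <- zrange a c) (F l - F (l - 1)) = F c - F (a - 1).
Proof.
move=> ac; rewrite /zrange big_map.
set N := absz _.
rewrite -[N in iota _ N]subn0 -/(index_iota 0 N).
rewrite (telescope_sumr_eq (fun i => F (a - 1 + i%:Z))) //.
  by congr (F _ - F _); lia.
by move=> i _; congr (F _ - F _); lia.
Qed.

(** * Pascal rules for Gaussian binomials *)

Lemma gauss_num_gt (n k : nat) : (n < k)%N -> gauss_num n k = 0.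
Proof.
move=> ltnk.
by rewrite /gauss_num (bigD1 (Ordinal ltnk)) //= subnn expr0 subrr mul0r.
Qed.

Lemma gauss_binom_out (n k : int) : ~~ (0 <= k <= n) -> gauss_binom n k = 0.
Proof. by move=> h; rewrite /gauss_binom ifF //; lia. Qed.

Lemma gauss_binom_den (n k : nat) :
  gauss_binom n k * gauss_den k = gauss_num n k.
Proof.
have [kn|nk] := leqP k n; first exact: gauss_binomK.
by rewrite gauss_num_gt // gauss_binom_out ?mul0r //; lia.
Qed.

Lemma gauss_den_inj (k : nat) (p q : {poly int}) :
  p * gauss_den k = q * gauss_den k -> p = q.
Proof. by apply/mulIf/monic_neq0/gauss_den_monic. Qed.

Lemma gauss_numSS (n k : nat) :
  gauss_num n.+1 k.+1 = ('X^(n.+1) - 1) * gauss_num n k.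
Proof. by rewrite /gauss_num big_ord_recl. Qed.

Lemma gauss_numS (n k : nat) :
  gauss_num n k.+1 = gauss_num n k * ('X^(n - k) - 1).
Proof. by rewrite /gauss_num big_ord_recr. Qed.

Lemma gauss_denS (k : nat) :
  gauss_den k.+1 = gauss_den k * ('X^(k.+1) - 1).
Proof. by rewrite /gauss_den big_ord_recr. Qed.

Lemma gauss_binom0 (n : nat) : gauss_binom n 0 = 1.
Proof.
apply: (@gauss_den_inj 0); rewrite gauss_binom_den mul1r.
by rewrite /gauss_num /gauss_den !big_ord0.
Qed.

(** Both q-Pascal rules come from splitting [x^(n+1) - 1] over the common
    denominator: [(x^(k+1) - 1) + x^(k+1) (x^(n-k) - 1)] gives this one,
    [(x^(n-k) - 1) + x^(n-k) (x^(k+1) - 1)] the next. *)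
Lemma gauss_pascal_low (n : nat) (k : int) :
  gauss_binom n.+1 k
  = gauss_binom n (k - 1) + 'X^`|k| * gauss_binom n k.
Proof.
case: k => [[|k]|k]; last by rewrite !gauss_binom_out ?mulr0 ?addr0 //; lia.
  by rewrite !gauss_binom0 gauss_binom_out ?add0r ?mul1r //; lia.
have -> : k.+1%:Z - 1 = k%:Z by lia.
apply: (@gauss_den_inj k.+1); rewrite mulrDl -mulrA !gauss_binom_den.
rewrite gauss_denS mulrA gauss_binom_den gauss_numSS gauss_numS absz_nat.
have [kn|nk] := leqP k n; last by rewrite gauss_num_gt //; ring.
have -> : n.+1 = (k.+1 + (n - k))%N by lia.
by rewrite exprD; set g := gauss_num n k; ring.
Qed.

Lemma gauss_pascal_high (n : nat) (k : int) :
  gauss_binom n.+1 k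
  = gauss_binom n k + 'X^`|n.+1%:Z - k| * gauss_binom n (k - 1).
Proof.
case: k => [[|k]|k]; last by rewrite !gauss_binom_out ?mulr0 ?addr0 //; lia.
  by rewrite !gauss_binom0 gauss_binom_out ?mulr0 ?addr0 //; lia.
have -> : k.+1%:Z - 1 = k%:Z by lia.
apply: (@gauss_den_inj k.+1); rewrite mulrDl -mulrA !gauss_binom_den.
rewrite gauss_denS [gauss_binom n k * _]mulrA gauss_binom_den
  gauss_numSS gauss_numS.
have [kn|nk] := leqP k n; last by rewrite gauss_num_gt //; ring.
have -> : `|n.+1%:Z - k.+1%:Z|%N = (n - k)%N by lia.
have -> : n.+1 = (k.+1 + (n - k))%N by lia.
by rewrite exprD; set g := gauss_num n k; ring.
Qed.

(** Absolute values in exponents may be computed as if their arguments were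
    nonnegative, because the binomial vanishes in the other cases. *)
Lemma gauss_binom_exp (n k : int) (i j : nat) :
  (0 <= k <= n -> i = j) ->
  'X^i * gauss_binom n k = 'X^j * gauss_binom n k.
Proof.
move=> h; have [/h-> //|nk] := boolP (0 <= k <= n).
by rewrite gauss_binom_out ?mulr0.
Qed.

(** Expanding row [m + 2] by the first rule and then row [m + 1] by the second
    produces [x^k x^(m+1-k) = x^(m+1)] in front of the binomial with lower entry
    [k - 1], which is what the recurrence subtracts. *)
Lemma gauss_defect_low (m : nat) (k : int) :
  gauss_binom m.+2 k - gauss_binom m.+1 (k - 1)
    - 'X^(m.+1) * gauss_binom m (k - 1)
  = 'X^`|k| * gauss_binom m k.
Proof.
rewrite gauss_pascal_low [gauss_binom m.+1 k]gauss_pascal_high.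
rewrite mulrDr mulrA -exprD.
rewrite (@gauss_binom_exp _ (k - 1) (`|k| + `|m.+1%:Z - k|) m.+1).
  by ring.
by lia.
Qed.

(** The same cancellation with the two rules applied in the opposite order,
    through [x^(m+2-k) x^(k-1) = x^(m+1)]. *)
Lemma gauss_defect_high (m : nat) (k : int) :
  gauss_binom m.+2 k - gauss_binom m.+1 k - 'X^(m.+1) * gauss_binom m (k - 1)
  = 'X^`|m.+2%:Z - k| * gauss_binom m (k - 2).
Proof.
rewrite gauss_pascal_high [gauss_binom m.+1 (k - 1)]gauss_pascal_low.
have -> : k - 1 - 1 = k - 2 by lia.
rewrite mulrDr [_ * (_ * _)]mulrA -exprD.
rewrite (@gauss_binom_exp _ (k - 1) (`|m.+2%:Z - k| + `|k - 1|) m.+1).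
  by ring.
by lia.
Qed.

(** * The exponents and the summands *)

Lemma b_ge0 (l : int) : 0 <= b l.
Proof. by rewrite /b; nia. Qed.

Lemma b_pred (l : int) : b l = b (l - 1) + (5 * l - 4).
Proof.
have -> : b l = (((5 * l - 4) * 2 + (5 * (l - 1) ^+ 2 - 3 * (l - 1))) %/ 2)%Z.
  by rewrite /b; congr (_ %/ _)%Z; ring.
by rewrite divzMDl // addrC.
Qed.

Definition term (n : nat) (l : int) : {poly int} :=
  (-1) ^ l * 'X^(`|b l|%N) * gauss_binom n%:Z ((n%:Z - 1 + 5 * l) %/ 2)%Z.

(** The binomial of row [m] surviving at [l] when [m + 1 + 5 l] is even.  Being
    zero at the other parity lets the difference [remainder m l -
    remainder m (l - 1)] describe both cases of the defect at once. *)
Definition remainder (m : nat) (l : int) : {poly int} :=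
  if (2 %| m%:Z + 1 + 5 * l)%Z then
    let k := ((m%:Z + 1 + 5 * l) %/ 2)%Z in
    (-1) ^ l * ('X^(`|b l| + `|k|) * gauss_binom m k)
  else 0.

Lemma remainder_out (m : nat) (l : int) :
  ~~ (- m.+1%:Z <= l <= m%:Z) -> remainder m l = 0.
Proof.
move=> h; rewrite /remainder; case: ifP => // _.
by rewrite gauss_binom_out ?mulr0 //; lia.
Qed.

Lemma sign_pred (l : int) : (-1 : {poly int}) ^ (l - 1) = - (-1) ^ l.
Proof. by rewrite exprzDr ?unitrN1 // exprN1 invrN1 mulrN1. Qed.

(** At the parity where [remainder m l] vanishes, the survivor has lower entry
    [k - 2] with [2 k = m + 5 l] and exponent [b l + (m + 2 - k)]; this equals
    the exponent [b (l - 1) + (k - 2)] of the remainder at [l - 1], because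
    [b l - b (l - 1) = 5 l - 4]. *)
Lemma term_defect (m : nat) (l : int) :
  term m.+2 l - term m.+1 l - 'X^(m.+1) * term m l
  = remainder m l - remainder m (l - 1).
Proof.
rewrite /term /remainder.
(* The divisibility tests at [l] and at [l - 1] are complementary, because
   5 is odd: exactly one of the two remainders is present. *)
have [ev|od] := boolP (2 %| m%:Z + 1 + 5 * l)%Z.
  rewrite ifF; last by lia.
  set k := ((m%:Z + 1 + 5 * l) %/ 2)%Z.
  have -> : ((m.+2%:Z - 1 + 5 * l) %/ 2)%Z = k by lia.
  have -> : ((m.+1%:Z - 1 + 5 * l) %/ 2)%Z = k - 1 by lia.
  have -> : ((m%:Z - 1 + 5 * l) %/ 2)%Z = k - 1 by lia.
  by rewrite subr0 exprD -[_ * _ * gauss_binom m k]mulrA -gauss_defect_low;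
    ring.
rewrite ifT; last by lia.
pose k := ((m%:Z + 5 * l) %/ 2)%Z.
have -> : ((m.+2%:Z - 1 + 5 * l) %/ 2)%Z = k by lia.
have -> : ((m.+1%:Z - 1 + 5 * l) %/ 2)%Z = k by lia.
have -> : ((m%:Z - 1 + 5 * l) %/ 2)%Z = k - 1 by lia.
have -> : ((m%:Z + 1 + 5 * (l - 1)) %/ 2)%Z = k - 2 by lia.
have -> : 'X^(`|b (l - 1)| + `|k - 2|) * gauss_binom m (k - 2)
        = 'X^(`|b l| + `|m.+2%:Z - k|) * gauss_binom m (k - 2).
  apply: gauss_binom_exp.
  by have := b_ge0 l; have := b_ge0 (l - 1); have := b_pred l; lia.
by rewrite sign_pred exprD -[_ * _ * gauss_binom m (k - 2)]mulrA
  -gauss_defect_high; ring.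
Qed.

(** The bounds in [Q] delimit the indices whose summand does not vanish, so any
    wider interval gives the same polynomial. *)
Lemma Q_wide (n N : nat) : (n < N)%N ->
  Q n = \sum_(l <- zrange (- N%:Z) N%:Z) term n l.
Proof.
move=> nN; apply: sum_zrange_wide; [lia | lia |] => l h.
by rewrite gauss_binom_out ?mulr0 //; lia.
Qed.

Theorem proposition5 :
  [/\ Q 0 = 0,
      Q 1 = 1
    & forall n : nat, (2 <= n)%N ->
        Q n = Q (n - 1)%N + 'X^(n - 1)%N * Q (n - 2)%N].
Proof.
split.
- (* The bounds are 1 and 0. *)
  by rewrite /Q big_nil.
- rewrite /Q big_seq1.
  by rewrite gauss_binom0 !mulr1.
case=> [|[|m]] // _; rewrite !subSS !subn0.
apply/eqP; rewrite -subr_eq0 opprD addrA; apply/eqP.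
rewrite !(@Q_wide _ m.+3); [|lia..].
rewrite mulr_sumr -!sumrB.
under eq_bigr => l _ do rewrite term_defect.
rewrite telescope_zrange; last by lia.
by rewrite !remainder_out ?subrr //; lia.
Qed.
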